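(* Inductive limits always exist in the category $\mathsf{Cu}$: for every inductive sequence $S_1\xrightarrow{\gamma_1}S_2\xrightarrow{\gamma_2}S_3\xrightarrow{\gamma_3}\cdots$ of objects and morphisms of $\mathsf{Cu}$ there exist an object $S$ of $\mathsf{Cu}$ and morphisms $\eta_i:S_i\to S$ in $\mathsf{Cu}$ with $\eta_{i+1}\circ\gamma_i=\eta_i$ for all $i$, such that for every object $T$ of $\mathsf{Cu}$ and every sequence of morphisms $\phi_i:S_i\to T$ in $\mathsf{Cu}$ with $\phi_{i+1}\circ\gamma_i=\phi_i$ for all $i$, there is a unique morphism $\phi:S\to T$ in $\mathsf{Cu}$ with $\phi_i=\phi\circ\eta_i$ for all $i$.
   Context: Category $\mathsf{Cu}$: an object is an ordered Abelian semigroup $S$ such that (O1) $S$ contains a zero element; (O2) $x_1+x_2\le y_1+y_2$ whenever $x_i\le y_i$, $i=1,2$; (O3) every countable upward directed set in $S$ has a supremum; (O4) writing $x\ll y$ if whenever $(y_n)$ is an increasing sequence with $\sup_n y_n\ge y$ there is $n$ with $x\le y_n$, for each $x\in S$ the set $x^{\ll}=\{y\in S: y\ll x\}$ is upward directed with respect to both $\le$ and $\ll$, and contains a sequence $(x_n)$ with $x_n\ll x_{n+1}$ for all $n$ and $\sup_n x_n=x$; (O5) if $S_1,S_2$ are countable upward directed sets in $S$, then $S_1+S_2$ is upward directed and $\sup(S_1+S_2)=\sup S_1+\sup S_2$; and if $x_i\ll y_i$ for $i=1,2$ then $x_1+x_2\ll y_1+y_2$; (O6) $x\ge 0$ for every $x\in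 S$. Morphisms of $\mathsf{Cu}$ are semigroup maps preserving (M1) the zero element, (M2) the order, (M3) suprema of countable upward directed sets, and (M4) the relation $\ll$. *)

(* Defs.v *)
From HB Require Import structures.
From mathcomp Require Import all_boot all_order.
From mathcomp Require Import all_classical.

Set Implicit Arguments.
Unset Strict Implicit.
Unset Printing Implicit Defensive.

Import Order.TTheory.
Local Open Scope classical_set_scope.
Local Open Scope order_scope.

(* Equality and order are boolean here, as everywhere in MathComp.  This is no
   restriction on the objects: classically every type carries eqType and
   choiceType structures and every relation is boolean (mathcomp.classical). *)

(* Directed sets are nonempty: if the empty set were allowed, additivity of
   suprema would fail for it, as the sum of a set with the empty set is empty. *)
Definition up_directed (T : Type) (r : T -> T -> Prop) (A : set T) : Prop :=
  A !=set0 /\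
  forall x y, A x -> A y -> exists z, [/\ A z, r x z & r y z].

Section OrderNotions.
Context {d : Order.disp_t} {T : porderType d}.

Definition le_directed (A : set T) : Prop := up_directed (fun x y => x <= y) A.

Definition way_below (x y : T) : Prop :=
  forall u : nat -> T, {homo u : m n / (m <= n)%N >-> m <= n} ->
  forall s, isLub (range u) s -> y <= s -> exists n, x <= u n.

End OrderNotions.

Notation "x ≪ y" := (way_below x y) (at level 70, no associativity) : order_scope.

(* A fixed display is used for the order of all objects, so that the objects of
   the category form a single type.  The addition is a field here because a
   join of Nmodule and POrder is incompatible with MathComp's porderZmodType. *)
Fact cu_display : Order.disp_t. Proof. exact: Order.Disp tt tt. Qed.

HB.mixin Record isCu S of Order.POrder cu_display S := {
  cu_zero : S;
  cu_add : S -> S -> S;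
  cu_addA : associative cu_add;
  cu_addC : commutative cu_add;
  cu_add0 : left_id cu_zero cu_add;
  cu_leD : forall x1 x2 y1 y2 : S,
    x1 <= y1 -> x2 <= y2 -> cu_add x1 x2 <= cu_add y1 y2;
  cu_has_lub : forall A : set S,
    countable A -> le_directed A -> exists s : S, isLub A s;
  cu_below_directed : forall x : S,
    le_directed [set y | y ≪ x] /\ up_directed way_below [set y | y ≪ x];
  cu_below_seq : forall x : S,
    exists u : nat -> S,
      [/\ forall n, u n ≪ x,
          forall n, u n ≪ u n.+1
        & isLub (range u) x];
  cu_sum_directed : forall A B : set S,
    countable A -> le_directed A -> countable B -> le_directed B ->
    le_directed [set cu_add x y | x in A & y in B];
  cu_lubD : forall (A B : set S) (s t : S),
    countable A -> le_directed A -> countable B -> le_directed B ->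
    isLub A s -> isLub B t ->
    isLub [set cu_add x y | x in A & y in B] (cu_add s t);
  cu_belowD : forall x1 x2 y1 y2 : S,
    x1 ≪ y1 -> x2 ≪ y2 -> cu_add x1 x2 ≪ cu_add y1 y2;
  cu_ge0 : forall x : S, cu_zero <= x
}.

#[short(type="cuType")]
HB.structure Definition Cu := { S of Order.POrder cu_display S & isCu S }.

Record cu_morphism (S T : cuType) (f : S -> T) : Prop := CuMorphism {
  cu_morphD : {morph f : x y / cu_add x y};
  cu_morph0 : f cu_zero = cu_zero;
  cu_morph_le : {homo f : x y / x <= y};
  cu_morph_lub : forall (A : set S) (s : S),
    countable A -> le_directed A -> isLub A s -> isLub (f @` A) (f s);
  cu_morph_below : forall x y : S, x ≪ y -> f x ≪ f y
}.

(* Main.v *)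
Require Import Defs.
From HB Require Import structures.
From mathcomp Require Import all_boot all_order.
From mathcomp Require Import all_classical.

Set Implicit Arguments.
Unset Strict Implicit.
Unset Printing Implicit Defensive.

Import Order.TTheory.
Local Open Scope classical_set_scope.
Local Open Scope order_scope.

(** Write gamma_{i,n} for the composite S_i -> S_n.  The limit cannot be the
    algebraic one: an increasing sequence whose terms come from later and later
    S_i need not have a supremum there.  So the algebraic limit is kept only as
    a source of approximations, and the limit is its completion by round ideals.

    Let W be the disjoint union of the S_i.  For v in S_i and w in S_j put
    v ≺ w when gamma_{i,n} v ≪ gamma_{j,n} w for some n >= i, j.  As the bonding
    maps preserve ≪, this then holds for all larger n, so ≺ is transitive and
    compatible with the addition of W computed at a common index.  A round ideal
    is a subset of W that is ≺-downward closed and ≺-directed; the limit L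
    consists of the round ideals with a countable cofinal subset, ordered by
    inclusion.  Taking sets of terms, rather than classes of increasing
    sequences, makes antisymmetry immediate and makes suprema of countable
    directed sets plain unions (lemma ideal_bigcup), so no diagonal argument is
    needed.

    Everything in L is governed by the principal ideals {v | v ≺ w}: every ideal
    is the supremum of an increasing sequence of them (ideal_lub_principal), and
    I ≪ J holds iff I is contained in the principal ideal of some element of J
    (ideal_way_belowP).  The axioms of Cu for L follow; they use only a few
    properties of (W, ≺, +), which are isolated in the record cu_basis.

    The maps S_i -> L send x to its principal ideal.  They preserve suprema
    because v ≺ sup A already gives v ≺ a for some a in A (term_prec_lub), and
    they are additive because x ≪ a + b gives x ≪ a' + b' with a' ≪ a and b' ≪ b
    (way_below_add).  A compatible family of morphisms into T amounts to a
    single map f on W, and the induced morphism is I |-> sup f(I)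
    (extension_morphism); it is the only one since principal ideals generate L
    under suprema of sequences (ideal_morphism_ext). *)

(** * Directed sets, chains and the way-below relation *)

Lemma countable_image (S T : Type) (f : S -> T) (A : set S) :
  countable A -> countable (f @` A).
Proof. by apply: sub_countable; exact: card_image_le. Qed.

(** Stated for an arbitrary relation r because it serves both the order of a
    directed set and the relation ≺ on a round ideal. *)
Lemma countable_chain (T : Type) (r : T -> T -> Prop) (A C : set T) :
  up_directed r A -> countable C -> C `<=` A ->
  exists d : nat -> T, [/\ forall n, A (d n), forall n, r (d n) (d n.+1)
    & forall c, C c -> exists n, r c (d n)].
Proof.
move=> [[a0 Aa0] dirA] /countable_injP[f injf] CA.
have /choice[c cP] : forall n, exists y, A y /\ forall x, C x -> f x = n -> x = y.
  move=> n; case: (pselect (exists x, C x /\ f x = n)) => [[x [Cx fx]]|nx].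
    exists x; split; first exact: CA.
    by move=> y Cy fy; apply: injf; rewrite ?inE// fy fx.
  by exists a0; split=> // x Cx fx; case: nx; exists x.
have /choice[g gP] : forall q : T * T, exists z, A q.1 -> A q.2 ->
    [/\ A z, r q.1 z & r q.2 z].
  move=> [x y]; case: (pselect (A x /\ A y)) => [[Ax Ay]|nA].
    by have [z zP] := dirA x y Ax Ay; exists z.
  by exists x => Ax Ay; case: nA.
(* At step n the chain moves above its last entry and above the n-th value of
   an enumeration of C. *)
pose d := fix d n := if n is m.+1 then g (d m, c m) else a0.
have Ad n : A (d n).
  elim: n => //= n IH.
  by have [] := gP (d n, c n) IH (cP n).1.
have dP n : r (d n) (d n.+1) /\ r (c n) (d n.+1).
  by have [] := gP (d n, c n) (Ad n) (cP n).1.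
exists d; split=> // [n|x Cx]; first exact: (dP n).1.
by exists (f x).+1; have := (dP (f x)).2; rewrite -((cP (f x)).2 x Cx erefl).
Qed.

Lemma le_directed_image (d d' : Order.disp_t) (S : porderType d)
    (T : porderType d') (f : S -> T) (A : set S) :
  {homo f : x y / x <= y} -> le_directed A -> le_directed (f @` A).
Proof.
move=> hf [[a Aa] dA]; split; first by exists (f a), a.
move=> _ _ [x Ax <-] [y Ay <-]; have [z [Az xz yz]] := dA x y Ax Ay.
by exists (f z); split; [exists z|exact: hf|exact: hf].
Qed.

Section PartialOrder.
Context {d : Order.disp_t} {T : porderType d}.
Implicit Types (x y z : T) (A : set T) (u : nat -> T).

Lemma isLub_unique A x y : isLub A x -> isLub A y -> x = y.
Proof.
by move=> [ubx lbx] [uby lby]; apply/le_anti; rewrite lbx// lby.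
Qed.

Lemma range_directed u : {homo u : m n / (m <= n)%N >-> m <= n} ->
  le_directed (range u).
Proof.
move=> hu; split; first by exists (u 0%N), 0%N.
move=> _ _ [m _ <-] [n _ <-]; exists (u (maxn m n)).
by split; [exists (maxn m n)|apply/hu/leq_maxl|apply/hu/leq_maxr].
Qed.

Lemma countable_range u : countable (range u).
Proof. exact: countable_image. Qed.

Lemma way_below_le x y : x ≪ y -> x <= y.
Proof.
move=> xy; have yub : isLub (range (fun _ : nat => y)) y.
  by split=> [_ [_ _ <-]//|b]; apply; exists 0%N.
by have [] := xy _ (fun m n _ => lexx y) y yub (lexx y).
Qed.

Lemma le_way_below x y z : x <= y -> y ≪ z -> x ≪ z.
Proof.
move=> xy yz u hu s us zs.
by have [n yn] := yz u hu s us zs; exists n; exact: le_trans yn.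
Qed.

Lemma way_below_le_trans x y z : x ≪ y -> y <= z -> x ≪ z.
Proof.
by move=> xy yz u hu s us zs; apply: (xy u hu s us); exact: le_trans yz zs.
Qed.

Lemma way_below_trans x y z : x ≪ y -> y ≪ z -> x ≪ z.
Proof. by move=> /way_below_le; exact: le_way_below. Qed.

Lemma way_below_chain u : (forall n, u n ≪ u n.+1) ->
  {homo u : m n / (m <= n)%N >-> m <= n}.
Proof.
move=> hu; apply: homo_leq => [//||n]; first exact: le_trans.
exact: way_below_le.
Qed.

(** The relation ≪ is defined by increasing sequences; a cofinal chain in the
    directed set A reduces to that case. *)
Lemma way_below_lub A s x : countable A -> le_directed A -> isLub A s ->
  x ≪ s -> exists2 y, A y & x <= y.
Proof.
move=> cA dA [ubs lbs] xs.
have [c [Ac cc cof]] := countable_chain dA cA (@subset_refl _ A).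
have hc : {homo c : m n / (m <= n)%N >-> m <= n}.
  by apply: homo_leq => //; exact: le_trans.
have [|n xn] := xs c hc s _ (lexx s); last by exists (c n).
split=> [_ [n _ <-]|b ub]; first exact: ubs.
apply: lbs => y Ay; have [n yn] := cof y Ay.
by apply: le_trans yn _; apply: ub; exists n.
Qed.

End PartialOrder.

(** * Objects and morphisms of Cu *)

Section CuTheory.
Context {S : cuType}.
Implicit Types (x y z a b : S).

Lemma way_below_interpolate x y : x ≪ y -> exists2 z, x ≪ z & z ≪ y.
Proof.
have [u [uy uu ulub]] := cu_below_seq y.
move=> /(_ u (way_below_chain uu) y ulub (lexx y))[n xn].
by exists (u n.+1) => //; apply: le_way_below xn _.
Qed.

Lemma way_below_approx x y : (forall z, z ≪ x -> z <= y) -> x <= y.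
Proof.
move=> h; have [u [ux _ [_]]] := cu_below_seq x; apply.
by move=> _ [n _ <-]; exact: h.
Qed.

Lemma way_below0 x : cu_zero ≪ x.
Proof.
have [u [ux _ _]] := cu_below_seq x.
by apply: le_way_below (ux 0%N); exact: cu_ge0.
Qed.

(** The sum a + b is the supremum of the sums of approximants of a and of b. *)
Lemma way_below_add x a b : x ≪ cu_add a b ->
  exists a' b', [/\ a' ≪ a, b' ≪ b & x ≪ cu_add a' b'].
Proof.
move=> /way_below_interpolate[y xy yab].
have [u [ua uu ulub]] := cu_below_seq a.
have [v [vb vv vlub]] := cu_below_seq b.
have [cu du] := (countable_range u, range_directed (way_below_chain uu)).
have [cv dv] := (countable_range v, range_directed (way_below_chain vv)).
have cuv : countable [set cu_add x y | x in range u & y in range v].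
  by rewrite image2E; apply: countable_image; exact: countableX.
have [_ [_ [m _ <-] [_ [n _ <-] <-]] yuv] := way_below_lub cuv
  (cu_sum_directed _ _ cu du cv dv) (cu_lubD _ _ _ _ cu du cv dv ulub vlub) yab.
by exists (u m), (v n); split=> //; exact: way_below_le_trans yuv.
Qed.

End CuTheory.

Lemma cu_morphism_id (S : cuType) : cu_morphism (@id S).
Proof. by split=> // A s _ _; rewrite image_id. Qed.

Lemma cu_morphism_comp (R S T : cuType) (f : R -> S) (g : S -> T) :
  cu_morphism f -> cu_morphism g -> cu_morphism (g \o f).
Proof.
move=> fP gP; split.
- by move=> x y /=; rewrite (cu_morphD fP) (cu_morphD gP).
- by rewrite /= (cu_morph0 fP) (cu_morph0 gP).
- by move=> x y xy; apply: (cu_morph_le gP); exact: (cu_morph_le fP).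
- move=> A s cA dA lubs; rewrite -image_comp.
  apply: (cu_morph_lub gP); first exact: countable_image.
    exact: le_directed_image (cu_morph_le fP) dA.
  exact: cu_morph_lub lubs.
- by move=> x y xy; apply: (cu_morph_below gP); exact: (cu_morph_below fP).
Qed.

Section MorphismTheory.
Context {S T : cuType} (f : S -> T) (fP : cu_morphism f).

Lemma cu_morph_lub_seq (u : nat -> S) s :
  {homo u : m n / (m <= n)%N >-> m <= n} -> isLub (range u) s ->
  isLub (range (f \o u)) (f s).
Proof.
move=> hu us.
have := cu_morph_lub fP (countable_range u) (range_directed hu) us.
by rewrite image_comp.
Qed.

End MorphismTheory.

(** * Bases and their countably generated round ideals *)

(** The part of the structure of the algebraic limit that survives without
    passing to a quotient.  The laws of addition are required only up to having
    the same ≺-predecessors, as sums of terms taken at different indices are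
    equal only after moving to a common later index.  Commutativity makes one
    implication of associativity enough. *)
Record cu_basis := CuBasis {
  basis_sort :> Type;
  prec : basis_sort -> basis_sort -> Prop;
  basis_zero : basis_sort;
  basis_add : basis_sort -> basis_sort -> basis_sort;
  prec_trans : forall v w x, prec v w -> prec w x -> prec v x;
  prec_approx : forall w, exists u : nat -> basis_sort,
    [/\ forall n, prec (u n) w, forall n, prec (u n) (u n.+1)
      & forall v, prec v w -> exists n, prec v (u n)];
  prec0 : forall w, prec basis_zero w;
  precD : forall v v' w w', prec v v' -> prec w w' ->
    prec (basis_add v w) (basis_add v' w');
  prec_add0 : forall v w, prec v (basis_add basis_zero w) -> prec v w;
  prec_0add : forall v w, prec v w -> prec v (basis_add basis_zero w);
  prec_addC : forall v a b, prec v (basis_add a b) -> prec v (basis_add b a);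
  prec_addA : forall v a b c, prec v (basis_add a (basis_add b c)) ->
    prec v (basis_add (basis_add a b) c)
}.

Notation "v ≺ w" := (prec v w) (at level 70, no associativity).
Notation "v ⊕ w" := (basis_add v w) (at level 50, left associativity).

Section Ideals.
Variable W : cu_basis.
Implicit Types v w : W.

(** Countable generation is stated by a cofinal countable subset, not by a
    chain: this form passes to countable directed unions at once.  A chain is
    recovered in ideal_chain. *)
Record ideal := Ideal {
  ideal_set :> W -> Prop;
  ideal_down : forall v w, v ≺ w -> ideal_set w -> ideal_set v;
  ideal_directed : up_directed (@prec W) ideal_set;
  ideal_countable : exists C : set W,
    [/\ countable C, C `<=` ideal_set &
        forall w, ideal_set w -> exists2 c, C c & w ≺ c]
}.

HB.instance Definition _ := gen_eqMixin ideal.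
HB.instance Definition _ := gen_choiceMixin ideal.

Implicit Types I J K : ideal.

Lemma ideal_eqP I J : (forall w, I w <-> J w) -> I = J.
Proof.
case: I J => [I I1 I2 I3] [J J1 J2 J3] /= IJ.
have eIJ : I = J by apply/seteqP; split=> w; rewrite IJ.
by subst J; congr Ideal; exact: Prop_irrelevance.
Qed.

Definition ideal_le I J := `[< ideal_set I `<=` ideal_set J >].

Lemma ideal_le_refl : reflexive ideal_le.
Proof. by move=> I; apply/asboolP. Qed.

Lemma ideal_le_anti : antisymmetric ideal_le.
Proof.
move=> I J /andP[/asboolP IJ /asboolP JI]; apply: ideal_eqP => w.
by split; [exact: IJ|exact: JI].
Qed.

Lemma ideal_le_trans : transitive ideal_le.
Proof.
move=> J I K /asboolP IJ /asboolP JK; apply/asboolP.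
exact: subset_trans JK.
Qed.

HB.instance Definition _ := Order.Le_isPOrder.Build cu_display ideal
  ideal_le_refl ideal_le_anti ideal_le_trans.

Lemma ideal_leP I J : reflect (ideal_set I `<=` ideal_set J) (I <= J).
Proof. exact: asboolP. Qed.

Lemma ideal_round I w : I w -> exists2 w', I w' & w ≺ w'.
Proof.
by move=> Iw; have [w' [? ? _]] := (ideal_directed I).2 w w Iw Iw; exists w'.
Qed.

Lemma ideal_chain I : exists c : nat -> W, [/\ forall n, I (c n),
  forall n, c n ≺ c n.+1 & forall w, I w -> exists n, w ≺ c n].
Proof.
have [C [cC CI genC]] := ideal_countable I.
have [c [Ic cc cof]] := countable_chain (ideal_directed I) cC CI.
exists c; split=> // w /genC[x /cof[n xn] wx].
by exists n; exact: prec_trans xn.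
Qed.

Lemma chain_prec (c : nat -> W) : (forall n, c n ≺ c n.+1) ->
  forall m n, (m < n)%N -> c m ≺ c n.
Proof.
move=> cc m; elim=> // n IH; rewrite ltnS leq_eqVlt => /predU1P[->//|/IH mn].
exact: prec_trans (cc n).
Qed.

Lemma chain_directed (c : nat -> W) (A : set W) : (forall n, c n ≺ c n.+1) ->
  (forall n, A (c n)) -> (forall w, A w -> exists n, w ≺ c n) ->
  up_directed (@prec W) A.
Proof.
move=> cc Ac cof; split; first by exists (c 0%N).
move=> v w /cof[m vm] /cof[n wn]; exists (c (maxn m n).+1); split=> //.
  by apply: prec_trans vm _; apply: chain_prec => //; rewrite ltnS leq_maxl.
by apply: prec_trans wn _; apply: chain_prec => //; rewrite ltnS leq_maxr.
Qed.

Lemma chain_countable (c : nat -> W) (A : set W) :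
  (forall n, A (c n)) -> (forall w, A w -> exists n, w ≺ c n) ->
  exists C : set W,
    [/\ countable C, C `<=` A & forall w, A w -> exists2 c, C c & w ≺ c].
Proof.
move=> Ac cof; exists (range c); split=> [|_ [n _ <-]//|w /cof[n wn]].
  exact: countable_image.
by exists (c n) => //; exists n.
Qed.

(** A ≺-increasing cofinal chain gives directedness and countable generation
    together; principal ideals and sums are built in this way. *)
Definition chain_ideal (A : set W) (down : forall v w, v ≺ w -> A w -> A v)
  (h : exists c : nat -> W, [/\ forall n, A (c n), forall n, c n ≺ c n.+1
    & forall w, A w -> exists n, w ≺ c n]) : ideal.
Proof.
apply: (@Ideal A) => //.
  by case: h => c [Ac cc cof]; exact: chain_directed cof.
by case: h => c [Ac cc cof]; exact: chain_countable cof.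
Defined.

Definition principal w : ideal :=
  @chain_ideal [set v | v ≺ w] (fun u v uv vw => prec_trans uv vw)
    (prec_approx w).

Lemma principal_le I w : I w -> principal w <= I.
Proof. by move=> Iw; apply/ideal_leP => v vw; exact: ideal_down Iw. Qed.

Lemma principal_mono v w : v ≺ w -> principal v <= principal w.
Proof. by move=> vw; exact: principal_le. Qed.

Lemma ideal_lub_principal I (c : nat -> W) : (forall n, I (c n)) ->
  (forall w, I w -> exists n, w ≺ c n) ->
  isLub (range (principal \o c)) I.
Proof.
move=> Ic cof; split=> [_ [n _ <-]|J ubJ]; first exact: principal_le.
apply/ideal_leP => w /cof[n wn].
have /ideal_leP : principal (c n) <= J by apply: ubJ; exists n.
exact.
Qed.

(** Directedness of A makes the union ≺-directed, and countability of A keeps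
    it countably generated. *)
Lemma ideal_bigcup (A : set ideal) : countable A -> le_directed A ->
  exists U : ideal, ideal_set U = \bigcup_(I in A) ideal_set I.
Proof.
move=> cA [[I0 AI0] dA].
have /choice[C CP] := ideal_countable.
suff [h1 [h2 h3]] : let U := \bigcup_(I in A) ideal_set I in
    (forall v w, v ≺ w -> U w -> U v) /\ (up_directed (@prec W) U /\
     exists C, [/\ countable C, C `<=` U &
       forall w, U w -> exists2 c, C c & w ≺ c]).
  by exists (Ideal h1 h2 h3).
split; first by move=> v w vw [I AI Iw]; exists I => //; exact: ideal_down Iw.
split.
  split.
    by have [[w Iw] _] := ideal_directed I0; exists w, I0.
  move=> v w [I AI Iv] [J AJ Jw].
  have [K [AK /ideal_leP IK /ideal_leP JK]] := dA I J AI AJ.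
  have [x [Kx vx wx]] := (ideal_directed K).2 v w (IK _ Iv) (JK _ Jw).
  by exists x; split=> //; exists K.
exists (\bigcup_(I in A) C I); split.
- by apply: bigcup_countable => // I _; case: (CP I).
- by move=> w [I AI Cw]; exists I => //; case: (CP I) => _ + _; exact.
- move=> w [I AI Iw]; have [_ _ /(_ w Iw)[c Cc wc]] := CP I.
  by exists c => //; exists I.
Qed.

Lemma isLub_bigcup (A : set ideal) U :
  ideal_set U = \bigcup_(I in A) ideal_set I -> isLub A U.
Proof.
move=> eU; split=> [I AI|J ubJ]; apply/ideal_leP; rewrite eU.
  by move=> w Iw; exists I.
by move=> w [I AI]; move: w; apply/ideal_leP/ubJ.
Qed.

(** Suprema are unique, so any supremum of A is the union of A. *)
Lemma isLub_mem (A : set ideal) U w : countable A -> le_directed A ->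
  isLub A U -> U w -> exists2 I, A I & ideal_set I w.
Proof.
move=> cA dA lubU Uw; have [V eV] := ideal_bigcup cA dA.
have eUV := isLub_unique lubU (isLub_bigcup eV).
by move: Uw; rewrite eUV eV => -[I]; exists I.
Qed.

(** J is the supremum of the principal ideals of a chain in J, so I ≪ J puts I
    below one of them.  Conversely, if w belongs to J and J lies below the
    supremum of a sequence, that supremum is a union, so some ideal u n of the
    sequence contains w and hence the principal ideal of w. *)
Lemma ideal_way_belowP I J : I ≪ J <-> exists2 w, J w & I <= principal w.
Proof.
split=> [IJ|[w Jw Iw] u hu s us Js].
  have [c [Jc cc cof]] := ideal_chain J.
  have [|n In] := IJ (principal \o c) _ J (ideal_lub_principal Jc cof) (lexx J).
    by apply: homo_leq => //; [exact: le_trans|move=> n; exact: principal_mono].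
  by exists (c n).
have [_ [n _ <-] unw] := isLub_mem (countable_range u) (range_directed hu) us
  (ideal_leP _ _ Js _ Jw).
by exists n; apply: le_trans Iw _; exact: principal_le.
Qed.

Lemma principal_way_below I w : I w -> principal w ≪ I.
Proof. by move=> Iw; apply/ideal_way_belowP; exists w. Qed.

(** * Addition of round ideals *)

Lemma idealD_down I J v w : v ≺ w ->
  (exists a b, [/\ I a, J b & w ≺ a ⊕ b]) ->
  exists a b, [/\ I a, J b & v ≺ a ⊕ b].
Proof.
by move=> vw [a [b [Ia Jb wab]]]; exists a, b; split=> //; exact: prec_trans wab.
Qed.

Lemma idealD_chain I J : exists c : nat -> W,
  [/\ forall n, exists a b, [/\ I a, J b & c n ≺ a ⊕ b], forall n, c n ≺ c n.+1
    & forall w, (exists a b, [/\ I a, J b & w ≺ a ⊕ b]) -> exists n, w ≺ c n].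
Proof.
have [c [Ic cc cofc]] := ideal_chain I.
have [d [Jd dd cofd]] := ideal_chain J.
have cd n : c n ⊕ d n ≺ c n.+1 ⊕ d n.+1 by exact: precD.
exists (fun n => c n ⊕ d n); split=> //.
  by move=> n; exists (c n.+1), (d n.+1).
move=> w [a [b [/cofc[m am] /cofd[n bn] wab]]]; exists (maxn m n).+1.
apply: prec_trans wab _; apply: precD.
  by apply: prec_trans am _; apply: chain_prec => //; rewrite ltnS leq_maxl.
by apply: prec_trans bn _; apply: chain_prec => //; rewrite ltnS leq_maxr.
Qed.

(** The sums a ⊕ b need not form a downward closed set, so I + J consists of
    their ≺-predecessors. *)
Definition idealD I J : ideal :=
  chain_ideal (@idealD_down I J) (idealD_chain I J).

Definition ideal0 : ideal := principal (basis_zero W).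

Lemma mem_idealD I J a b : I a -> J b -> idealD I J (a ⊕ b).
Proof.
move=> /ideal_round[a' Ia' aa'] /ideal_round[b' Jb' bb'].
by exists a', b'; split=> //; exact: precD.
Qed.

Lemma idealDC : commutative idealD.
Proof.
suff h I J w : idealD I J w -> idealD J I w.
  by move=> I J; apply: ideal_eqP; split; exact: h.
by move=> [a [b [Ia Jb wab]]]; exists b, a; split=> //; exact: prec_addC.
Qed.

(** One inclusion suffices: conjugating it by commutativity gives the other. *)
Lemma idealDA : associative idealD.
Proof.
have h I J K : idealD I (idealD J K) <= idealD (idealD I J) K.
  apply/ideal_leP => w [a [u [/ideal_round[a' Ia' aa'] [b [c [Jb Kc ubc]]] wau]]].
  exists (a' ⊕ b), c; split=> //; first exact: mem_idealD.
  by apply: prec_addA; apply: prec_trans wau _; exact: precD.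
move=> I J K; apply/le_anti; rewrite h /=.
by rewrite (idealDC I J) (idealDC _ K) (idealDC J K) (idealDC I).
Qed.

Lemma ideal0D : left_id ideal0 idealD.
Proof.
move=> I; apply: ideal_eqP => w; split.
  move=> [a [b [a0 /ideal_round[b' Ib' bb'] wab]]].
  apply: ideal_down Ib'; apply: prec_add0.
  by apply: prec_trans wab _; exact: precD.
move=> /ideal_round[w' Iw' ww']; exists (basis_zero W), w'; split=> //.
  exact: prec0.
exact: prec_0add.
Qed.

Lemma idealD_le I I' J J' : I <= J -> I' <= J' -> idealD I I' <= idealD J J'.
Proof.
move=> /ideal_leP IJ /ideal_leP IJ'; apply/ideal_leP => w [a [b [Ia Ib wab]]].
by exists a, b; split=> //; [exact: IJ|exact: IJ'].
Qed.

Lemma ideal_has_lub (A : set ideal) : countable A -> le_directed A ->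
  exists s, isLub A s.
Proof. by move=> cA /(ideal_bigcup cA)[U eU]; exists U; exact: isLub_bigcup. Qed.

Lemma ideal_below_directed I : le_directed [set J | J ≪ I] /\
  up_directed way_below [set J | J ≪ I].
Proof.
suff h : up_directed way_below [set J | J ≪ I].
  split=> //; split; first exact: h.1.
  move=> J K JI KI; have [L [LI JL KL]] := h.2 J K JI KI.
  by exists L; split=> //; exact: way_below_le.
split.
  have [[w Iw] _] := ideal_directed I; exists (principal w).
  exact: principal_way_below.
move=> J K /ideal_way_belowP[v Iv Jv] /ideal_way_belowP[w Iw Kw].
have [x [Ix vx wx]] := (ideal_directed I).2 v w Iv Iw.
exists (principal x); split; first exact: principal_way_below.
  by apply/ideal_way_belowP; exists v.
by apply/ideal_way_belowP; exists w.
Qed.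

Lemma ideal_below_seq I : exists u : nat -> ideal,
  [/\ forall n, u n ≪ I, forall n, u n ≪ u n.+1 & isLub (range u) I].
Proof.
have [c [Ic cc cof]] := ideal_chain I.
exists (principal \o c); split.
- by move=> n; exact: principal_way_below (Ic n).
- by move=> n; apply: (@principal_way_below (principal (c n.+1))); exact: cc.
- exact: ideal_lub_principal.
Qed.

Lemma idealD_directed (A B : set ideal) :
  countable A -> le_directed A -> countable B -> le_directed B ->
  le_directed [set idealD I J | I in A & J in B].
Proof.
move=> _ [[I0 AI0] dA] _ [[J0 BJ0] dB]; split.
  by exists (idealD I0 J0), I0 => //; exists J0.
move=> _ _ [I AI [J BJ <-]] [I' AI' [J' BJ' <-]].
have [I1 [AI1 II1 II1']] := dA _ _ AI AI'.
have [J1 [BJ1 JJ1 JJ1']] := dB _ _ BJ BJ'.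
exists (idealD I1 J1); split; try exact: idealD_le.
by exists I1 => //; exists J1.
Qed.

Lemma idealD_lub (A B : set ideal) (s t : ideal) :
  countable A -> le_directed A -> countable B -> le_directed B ->
  isLub A s -> isLub B t ->
  isLub [set idealD I J | I in A & J in B] (idealD s t).
Proof.
move=> cA dA cB dB lubs lubt; split.
  by move=> _ [I AI [J BJ <-]]; apply: idealD_le; [apply: lubs.1|apply: lubt.1].
move=> K ubK; apply/ideal_leP => w [a [b [sa tb wab]]].
have [I AI Ia] := isLub_mem cA dA lubs sa.
have [J BJ Jb] := isLub_mem cB dB lubt tb.
have /ideal_leP : idealD I J <= K by apply: ubK; exists I => //; exists J.
by apply; exists a, b.
Qed.

Lemma idealD_below I I' J J' : I ≪ J -> I' ≪ J' -> idealD I I' ≪ idealD J J'.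
Proof.
move=> /ideal_way_belowP[w Jw /ideal_leP Iw] /ideal_way_belowP[w' Jw' /ideal_leP Iw'].
apply/ideal_way_belowP; exists (w ⊕ w'); first exact: mem_idealD.
apply/ideal_leP => v [a [b [/Iw aw /Iw' bw vab]]].
by apply: prec_trans vab _; exact: precD.
Qed.

Lemma ideal_ge0 I : ideal0 <= I.
Proof.
apply/ideal_leP => w w0; have [[v Iv] _] := ideal_directed I.
by apply: ideal_down Iv; apply: prec_trans w0 _; exact: prec0.
Qed.

HB.instance Definition _ := @isCu.Build ideal ideal0 idealD idealDA idealDC
  ideal0D (fun I I' J J' => @idealD_le I I' J J') ideal_has_lub
  ideal_below_directed ideal_below_seq idealD_directed idealD_lub
  (fun I I' J J' => @idealD_below I I' J J') ideal_ge0.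

End Ideals.

(** * Morphisms out of the ideal completion *)

(** A map f on the basis extends to ideals by I |-> sup f(I).  The supremum
    exists although f(I) may be uncountable, because a countable chain is cofinal
    in I.  The hypothesis f_cont says that f w is the supremum of the values of f
    below w; it makes the extension agree with f on principal ideals. *)
Section Extension.
Variables (W : cu_basis) (T : cuType) (f : W -> T).
Hypothesis f_below : forall v w, v ≺ w -> f v ≪ f w.
Hypothesis f0 : f (basis_zero W) = cu_zero.
Hypothesis fD : forall v w, f (v ⊕ w) = cu_add (f v) (f w).
Hypothesis f_cont : forall w z, (forall v, v ≺ w -> f v <= z) -> f w <= z.

Lemma extension_lub_chain (I : ideal W) (c : nat -> W) :
  (forall n, I (c n)) -> (forall w, I w -> exists n, w ≺ c n) ->
  forall t, isLub (range (f \o c)) t <-> isLub (f @` ideal_set I) t.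
Proof.
move=> Ic cof.
have ubE z : ubound (range (f \o c)) z <-> ubound (f @` ideal_set I) z.
  split=> ubz.
    move=> _ [w /cof[n wn] <-]; apply: le_trans (way_below_le (f_below wn)) _.
    by apply: ubz; exists n.
  by move=> _ [n _ <-]; apply: ubz; exists (c n).
move=> t; split=> lubt.
  by split=> [|z ubz]; [apply/ubE/lubt.1|apply/lubt.2/ubE].
by split=> [|z ubz]; [apply/ubE/lubt.1|apply/lubt.2/ubE].
Qed.

Lemma extension_exists (I : ideal W) : exists t, isLub (f @` ideal_set I) t.
Proof.
have [c [Ic cc cof]] := ideal_chain I.
have hc : {homo (f \o c) : m n / (m <= n)%N >-> m <= n}.
  by apply: way_below_chain => n; exact: f_below.
have [t lubt] := cu_has_lub _ (countable_range (f \o c)) (range_directed hc).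
by exists t; apply/(extension_lub_chain Ic cof).
Qed.

Definition extension (I : ideal W) : T := projT1 (cid (extension_exists I)).

Lemma extensionP (I : ideal W) : isLub (f @` ideal_set I) (extension I).
Proof. by rewrite /extension; case: cid. Qed.

Lemma extension_ge (I : ideal W) w : I w -> f w <= extension I.
Proof. by move=> Iw; apply: (extensionP I).1; exists w. Qed.

Lemma extension_le (I : ideal W) z : (forall w, I w -> f w <= z) ->
  extension I <= z.
Proof. by move=> h; apply: (extensionP I).2 => _ [w Iw <-]; exact: h. Qed.

Lemma extension_principal w : extension (principal w) = f w.
Proof.
apply/le_anti/andP; split.
  by apply: extension_le => v vw; exact: way_below_le (f_below vw).
by apply: f_cont => v vw; exact: extension_ge.
Qed.

Lemma extension_morphism : cu_morphism extension.
Proof.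
have mono : {homo extension : I J / I <= J}.
  move=> I J /ideal_leP IJ; apply: extension_le => w /IJ; exact: extension_ge.
split=> //.
- move=> I J; apply/le_anti/andP; split.
    apply: extension_le => w [a [b [Ia Jb wab]]].
    apply: le_trans (way_below_le (f_below wab)) _; rewrite fD.
    by apply: cu_leD; exact: extension_ge.
  have [c [Ic cc cofc]] := ideal_chain I.
  have [d [Jd dd cofd]] := ideal_chain J.
  have hc : {homo (f \o c) : m n / (m <= n)%N >-> m <= n}.
    by apply: way_below_chain => n; exact: f_below.
  have hd : {homo (f \o d) : m n / (m <= n)%N >-> m <= n}.
    by apply: way_below_chain => n; exact: f_below.
  have [_] := cu_lubD _ _ _ _ (countable_range _) (range_directed hc)
    (countable_range _) (range_directed hd)
    ((extension_lub_chain Ic cofc _).2 (extensionP I))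
    ((extension_lub_chain Jd cofd _).2 (extensionP J)).
  apply=> _ [_ [m _ <-] [_ [n _ <-] <-]] /=.
  by rewrite -fD; apply: extension_ge; exact: mem_idealD.
- by rewrite extension_principal.
- move=> A s cA dA lubs; split.
    by move=> _ [I AI <-]; apply: mono; apply: lubs.1.
  move=> z ubz; apply: extension_le => w /(isLub_mem cA dA lubs)[I AI Iw].
  by apply: le_trans (extension_ge Iw) _; apply: ubz; exists I.
- move=> I J /ideal_way_belowP[w /ideal_round[w' Jw' ww'] Iw].
  apply: le_way_below (mono _ _ Iw) _; rewrite extension_principal.
  by apply: way_below_le_trans (f_below ww') _; exact: extension_ge.
Qed.

End Extension.

(** Every ideal is the supremum of a sequence of principal ideals, and
    morphisms preserve such suprema. *)
Lemma ideal_morphism_ext (W : cu_basis) (T : cuType) (g h : ideal W -> T) :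
  cu_morphism g -> cu_morphism h ->
  (forall w, g (principal w) = h (principal w)) -> g = h.
Proof.
move=> gP hP gh; apply/funext => I.
have [c [Ic cc cof]] := ideal_chain I.
have hc : {homo (@principal W \o c) : m n / (m <= n)%N >-> m <= n}.
  by apply: way_below_chain => n;
    apply: (@principal_way_below _ (principal (c n.+1))); exact: cc.
have lubI := ideal_lub_principal Ic cof.
apply: isLub_unique (cu_morph_lub_seq gP hc lubI) _.
rewrite (_ : g \o _ = h \o (@principal W \o c)); last by apply/funext => n /=.
exact: (cu_morph_lub_seq hP hc lubI).
Qed.

(** * The basis of an inductive sequence *)

Section InductiveSequence.
Variables (S : nat -> cuType) (gamma : forall i, S i -> S i.+1).
Hypothesis gammaP : forall i, cu_morphism (@gamma i).

(** The composite S_i -> S_j of the bonding maps, made total by the value 0 for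
    j < i.  Having the target index as an argument avoids casts between
    S_(i + m + n) and S_(i + (m + n)). *)
Fixpoint transition (j i : nat) (x : S i) {struct j} : S j :=
  match @eqP _ i j with
  | ReflectT ij => eq_rect i (fun k => S k : Type) x j ij
  | ReflectF _ => if j is k.+1 then gamma (transition k x) else cu_zero
  end.

Lemma transition_id i (x : S i) : transition i x = x.
Proof.
by case: i x => [|i] x /=; case: eqP => // e; rewrite (eq_irrelevance e erefl).
Qed.

Lemma transitionS i j (x : S i) : (i <= j)%N ->
  transition j.+1 x = gamma (transition j x).
Proof.
by move=> ij /=; case: eqP => // e; rewrite e ltnn in ij.
Qed.

Lemma transition_morphism i j : (i <= j)%N -> cu_morphism (@transition j i).
Proof.
elim: j => [|j IH].
  rewrite leqn0 => /eqP i0; subst i.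
  by rewrite (_ : @transition 0 0 = id);
    [exact: cu_morphism_id|apply/funext => x; exact: transition_id].
rewrite leq_eqVlt => /predU1P[->|]; last rewrite ltnS => ij.
  by rewrite (_ : @transition j.+1 j.+1 = id);
    [exact: cu_morphism_id|apply/funext => x; exact: transition_id].
rewrite (_ : @transition j.+1 i = @gamma j \o @transition j i).
  by apply: cu_morphism_comp; first exact: IH.
by apply/funext => x; exact: transitionS.
Qed.

Lemma transition_comp i j k (x : S i) : (i <= j)%N -> (j <= k)%N ->
  transition k (transition j x) = transition k x.
Proof.
move=> ij; elim: k => [|k IH].
  by rewrite leqn0 => /eqP j0; subst j; rewrite transition_id.
rewrite leq_eqVlt => /predU1P[<-|]; first by rewrite transition_id.
by rewrite ltnS => jk; rewrite !transitionS ?IH//; exact: leq_trans jk.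
Qed.

Local Notation term := {i : nat & S i}.
Local Notation term_of x := (Tagged (fun i => S i : Type) x).
Implicit Types v w : term.

Definition at_level n w : S n := transition n (tagged w).

(** The bounds on n exclude the indices at which transition takes its default
    value. *)
Definition term_prec v w : Prop :=
  exists n, [/\ (tag v <= n)%N, (tag w <= n)%N & at_level n v ≪ at_level n w].

Definition term_zero : term := term_of (cu_zero : S 0%N).

Definition term_add v w : term :=
  let n := maxn (tag v) (tag w) in
  term_of (cu_add (at_level n v) (at_level n w)).

Lemma at_level_transition m n w : (tag w <= m)%N -> (m <= n)%N ->
  transition n (at_level m w) = at_level n w.
Proof. by move=> wm mn; rewrite /at_level transition_comp. Qed.

Lemma at_level0 n : at_level n term_zero = cu_zero.
Proof. by rewrite /at_level (cu_morph0 (transition_morphism (leq0n n))). Qed.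

Lemma at_levelD n v w : (maxn (tag v) (tag w) <= n)%N ->
  at_level n (term_add v w) = cu_add (at_level n v) (at_level n w).
Proof.
move=> mn; rewrite {1}/at_level (cu_morphD (transition_morphism mn)).
by rewrite !at_level_transition// ?leq_maxl ?leq_maxr.
Qed.

Lemma at_level_below m n v w : (tag v <= m)%N -> (tag w <= m)%N -> (m <= n)%N ->
  at_level m v ≪ at_level m w -> at_level n v ≪ at_level n w.
Proof.
move=> vm wm mn vw; rewrite -(at_level_transition vm mn) -(at_level_transition wm mn).
exact: (cu_morph_below (transition_morphism mn)).
Qed.

(** Two relations ≺ can hence be tested at one common index. *)
Lemma term_precE v w : term_prec v w ->
  exists N, forall n, (N <= n)%N ->
    [/\ (tag v <= n)%N, (tag w <= n)%N & at_level n v ≪ at_level n w].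
Proof.
move=> [N [vN wN vw]]; exists N => n Nn.
by split; [exact: leq_trans Nn|exact: leq_trans Nn|exact: at_level_below vw].
Qed.

Lemma term_prec_trans v w x : term_prec v w -> term_prec w x -> term_prec v x.
Proof.
move=> /term_precE[M hM] /term_precE[N hN]; exists (maxn M N).
have [vn wn vw] := hM _ (leq_maxl M N); have [_ xn wx] := hN _ (leq_maxr M N).
by split=> //; exact: way_below_trans wx.
Qed.

Lemma term_prec_same i (x y : S i) : x ≪ y ->
  term_prec (term_of x) (term_of y).
Proof. by move=> xy; exists i; rewrite /at_level !transition_id. Qed.

(** Suprema of the stage S_i remain suprema for ≺: the transition maps preserve
    them, and interpolating a y below the image of s keeps the relation strict
    once some a has been found above y. *)
Lemma term_prec_lub (i : nat) (A : set (S i)) s v :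
  countable A -> le_directed A -> isLub A s ->
  term_prec v (term_of s) ->
  exists2 a, A a & term_prec v (term_of a).
Proof.
move=> cA dA lubs [n [vn /= jn]] /way_below_interpolate[y vy ys].
have tP := transition_morphism jn.
have [_ [a Aa <-] ya] := way_below_lub (countable_image _ cA)
  (le_directed_image (cu_morph_le tP) dA) (cu_morph_lub tP cA dA lubs) ys.
by exists a => //; exists n; split=> //; exact: way_below_le_trans ya.
Qed.

Lemma term_prec_approx w : exists u : nat -> term,
  [/\ forall n, term_prec (u n) w, forall n, term_prec (u n) (u n.+1)
    & forall v, term_prec v w -> exists n, term_prec v (u n)].
Proof.
case: w => i x; have [u [ux uu ulub]] := cu_below_seq x.
exists (fun n => term_of (u n)); split.
- by move=> n; exact: term_prec_same.
- by move=> n; exact: term_prec_same.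
- move=> v vx.
  have [_ [n _ <-] vn] := term_prec_lub (countable_range u)
    (range_directed (way_below_chain uu)) ulub vx.
  by exists n.
Qed.

Lemma term_prec0 w : term_prec term_zero w.
Proof. by exists (tag w); rewrite at_level0; split=> //; exact: way_below0. Qed.

Lemma term_precD v v' w w' : term_prec v v' -> term_prec w w' ->
  term_prec (term_add v w) (term_add v' w').
Proof.
move=> /term_precE[M hM] /term_precE[N hN]; exists (maxn M N).
have [vn vn' vv] := hM _ (leq_maxl M N); have [wn wn' ww] := hN _ (leq_maxr M N).
have hn : (maxn (tag v) (tag w) <= maxn M N)%N by rewrite geq_max vn wn.
have hn' : (maxn (tag v') (tag w') <= maxn M N)%N by rewrite geq_max vn' wn'.
by split=> //; rewrite !at_levelD//; exact: cu_belowD.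
Qed.

(** Equality at every common index is the form in which the laws of addition
    hold for terms. *)
Lemma term_prec_congr v w w' : tag w = tag w' ->
  (forall n, (tag w <= n)%N -> at_level n w = at_level n w') ->
  term_prec v w -> term_prec v w'.
Proof.
by move=> ww' eww' [n [vn wn vw]]; exists n; rewrite -ww' -eww'.
Qed.

Lemma at_level_add0 n w : (tag w <= n)%N ->
  at_level n (term_add term_zero w) = at_level n w.
Proof. by move=> wn; rewrite at_levelD ?max0n// at_level0 cu_add0. Qed.

Lemma term_prec_add0 v w : term_prec v (term_add term_zero w) -> term_prec v w.
Proof. by apply: term_prec_congr => [|n]; rewrite /= max0n//; exact: at_level_add0. Qed.

Lemma term_prec_0add v w : term_prec v w -> term_prec v (term_add term_zero w).
Proof.
apply: term_prec_congr => [|n wn]; first by rewrite /= max0n.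
by rewrite at_level_add0.
Qed.

Lemma term_prec_addC v a b : term_prec v (term_add a b) -> term_prec v (term_add b a).
Proof.
apply: term_prec_congr => [|n abn]; first by rewrite /= maxnC.
by rewrite !at_levelD// 1?maxnC// cu_addC.
Qed.

Lemma term_prec_addA v a b c :
  term_prec v (term_add a (term_add b c)) ->
  term_prec v (term_add (term_add a b) c).
Proof.
apply: term_prec_congr => [|n]; first by rewrite /= maxnA.
rewrite /= !geq_max => /and3P[an bn cn].
by rewrite !at_levelD ?geq_max ?an ?bn ?cn// cu_addA.
Qed.

Definition sequence_basis : cu_basis :=
  CuBasis term_prec_trans term_prec_approx term_prec0 term_precD term_prec_add0
    term_prec_0add term_prec_addC term_prec_addA.

(** * The inductive limit *)

Definition limit_map i (x : S i) : ideal sequence_basis :=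
  @principal sequence_basis (term_of x).

Lemma limit_map_morphism i : cu_morphism (@limit_map i).
Proof.
have mono : {homo @limit_map i : x y / x <= y}.
  move=> x y xy; apply/ideal_leP => v [n [vn /= xn vx]].
  exists n; split=> //; apply: way_below_le_trans vx _.
  exact: (cu_morph_le (transition_morphism xn)).
split=> //.
- move=> x y; apply: ideal_eqP => v; split.
    move=> [n [vn /= xyn]]; rewrite /at_level /= (cu_morphD (transition_morphism xyn)).
    move=> /way_below_add[x' [y' [xx' yy' vxy]]].
    exists (term_of x'), (term_of y').
    split.
    + by exists n; rewrite /at_level /= transition_id.
    + by exists n; rewrite /at_level /= transition_id.
    + exists n; rewrite /= maxnn at_levelD ?maxnn//.
      by rewrite {2 3}/at_level /= !transition_id.
  move=> [a [b [ax b_y vab]]].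
  have := term_prec_trans vab (term_precD ax b_y).
  apply: term_prec_congr => [|n]; rewrite /= maxnn// => xn.
  rewrite at_levelD ?maxnn// /at_level /=.
  by rewrite (cu_morphD (transition_morphism xn)).
- apply: ideal_eqP => v; split.
    move=> [n [vn /= xn]]; rewrite /at_level /= (cu_morph0 (transition_morphism xn)) => v0.
    by exists n; rewrite at_level0.
  move=> /term_precE[N hN]; exists (maxn N i).
  have [vn _] := hN _ (leq_maxl N i); rewrite at_level0 => v0.
  split=> //=; first exact: leq_maxr.
  by rewrite {2}/at_level (cu_morph0 (transition_morphism (leq_maxr N i))).
- move=> A s cA dA lubs; split.
    by move=> _ [x Ax <-]; apply: mono; exact: lubs.1.
  move=> K ubK; apply/ideal_leP => v /(term_prec_lub cA dA lubs)[a Aa va].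
  have /ideal_leP : limit_map a <= K by apply: ubK; exists a.
  exact.
- by move=> x y xy; apply: (@principal_way_below sequence_basis); exact: term_prec_same.
Qed.

Lemma limit_map_compat i : @limit_map i.+1 \o @gamma i = @limit_map i.
Proof.
have e (x : S i) n : (i < n)%N -> transition n (gamma x) = transition n x.
  move=> ltin; rewrite -[in RHS](@transition_comp i i.+1 n x)//.
  by rewrite transitionS// transition_id.
apply/funext => x; apply: ideal_eqP => v; split.
  move=> [n [vn /= xn]]; rewrite /at_level /= e// => vx.
  by exists n; split=> //=; exact: ltnW.
move=> /term_precE[N hN]; exists (maxn N i.+1).
have [vn _ vx] := hN _ (leq_maxl N i.+1).
split=> //=; first exact: leq_maxr.
by rewrite {2}/at_level /= e// leq_maxr.
Qed.

Section Cocone.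
Variables (T : cuType) (phi : forall i, S i -> T).
Hypothesis phiP : forall i, cu_morphism (@phi i).
Hypothesis phi_compat : forall i, @phi i.+1 \o @gamma i = @phi i.

(** Terms that become equal at a later index have the same image, by
    compatibility of phi; this is why phi can be treated as one map on terms. *)
Definition term_image w : T := phi (tagged w).

Lemma term_image_level n w : (tag w <= n)%N ->
  phi (at_level n w) = term_image w.
Proof.
rewrite /at_level /term_image; case: w => i x /=.
elim: n => [|n IH].
  by rewrite leqn0 => /eqP i0; subst i; rewrite transition_id.
rewrite leq_eqVlt => /predU1P[e|]; first by subst i; rewrite transition_id.
rewrite ltnS => le_in; rewrite transitionS// -IH//.
by rewrite -[in RHS](phi_compat n).
Qed.

Lemma term_image_below v w : term_prec v w -> term_image v ≪ term_image w.
Proof.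
move=> [n [vn wn vw]]; rewrite -(term_image_level vn) -(term_image_level wn).
exact: (cu_morph_below (phiP n)).
Qed.

Lemma term_imageD v w :
  term_image (term_add v w) = cu_add (term_image v) (term_image w).
Proof.
rewrite -(term_image_level (leq_maxl (tag v) (tag w))).
by rewrite -(term_image_level (leq_maxr (tag v) (tag w))) -(cu_morphD (phiP _)).
Qed.

Lemma term_image_cont w z :
  (forall v, term_prec v w -> term_image v <= z) -> term_image w <= z.
Proof.
case: w => i x h; have [u [ux uu ulub]] := cu_below_seq x.
apply: (cu_morph_lub_seq (phiP i) (way_below_chain uu) ulub).2 => _ [n _ <-].
by apply: (h (term_of (u n))); exact: term_prec_same.
Qed.

Lemma limit_map_universal : exists! psi : ideal sequence_basis -> T,
  cu_morphism psi /\ (forall i, @phi i = psi \o @limit_map i).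
Proof.
have f0 : term_image (basis_zero sequence_basis) = cu_zero.
  by exact: (cu_morph0 (phiP 0%N)).
pose psi := @extension sequence_basis T term_image term_image_below.
have psi_principal w : psi (@principal sequence_basis w) = term_image w.
  exact: (@extension_principal sequence_basis T _ term_image_below term_image_cont).
have psiP : cu_morphism psi.
  exact: (@extension_morphism sequence_basis T _ term_image_below f0 term_imageD
    term_image_cont).
exists psi; split.
  by split=> // i; apply/funext => x; rewrite /= psi_principal.
move=> psi' [psi'P psi'E]; apply: ideal_morphism_ext => // -[i x].
by rewrite psi_principal /term_image /= psi'E.
Qed.

End Cocone.
End InductiveSequence.

Theorem theorem4p34 (S : nat -> cuType) (gamma : forall i : nat, S i -> S i.+1)
  (gammaP : forall i : nat, cu_morphism (gamma i)) :
  exists (L : cuType) (eta : forall i : nat, S i -> L),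
    [/\ forall i : nat, cu_morphism (eta i),
        forall i : nat, eta i.+1 \o gamma i = eta i
      & forall (T : cuType) (phi : forall i : nat, S i -> T),
          (forall i : nat, cu_morphism (phi i)) ->
          (forall i : nat, phi i.+1 \o gamma i = phi i) ->
          exists! psi : L -> T,
            cu_morphism psi /\ (forall i : nat, phi i = psi \o eta i)].
Proof.
exists (ideal (sequence_basis gammaP)), (@limit_map S gamma gammaP); split.
- exact: limit_map_morphism.
- exact: limit_map_compat.
- by move=> T phi phiP phi_compat; exact: limit_map_universal.
Qed.
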